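(* There are infinitely many pairwise non-isomorphic finite simple graphs that are connected $6$-valent Cayley graphs and have no Hamilton decomposition.
   Context: A graph is $k$-valent if every vertex has degree $k$. A Hamilton decomposition of a $k$-valent graph $X$ is a set of $\lfloor k/2\rfloor$ pairwise edge-disjoint Hamilton cycles in $X$. A graph is a Cayley graph if it is isomorphic to $\mathrm{Cay}(G;S)$ for some group $G$ and some inverse-closed subset $S\subseteq G$ not containing the identity, where $\mathrm{Cay}(G;S)$ has vertex set $G$ and edges $\{g,gs\}$ for $g\in G$, $s\in S$; equivalently, its automorphism group has a subgroup acting regularly on the vertices. *)

(* Defs.v *)
From mathcomp Require Import all_boot all_fingroup.

Set Implicit Arguments.
Unset Strict Implicit.
Unset Printing Implicit Defensive.

Record sgraph := SGraph {
  vertex :> finType;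
  adj : rel vertex;
  adj_sym : symmetric adj;
  adj_irrefl : irreflexive adj }.

Definition graph_iso (X Y : sgraph) : Prop :=
  exists f : X -> Y, bijective f /\ forall x y : X, adj (f x) (f y) = adj x y.

Definition connected_graph (X : sgraph) : Prop :=
  0 < #|X| /\ forall x y : X, connect (@adj X) x y.

Definition valent (k : nat) (X : sgraph) : Prop :=
  forall x : X, #|[set y | adj x y]| = k.

Definition cycle_edges (T : finType) (c : seq T) : {set {set T}} :=
  [set [set x; next c x] | x in c].

(* Cycles are subgraphs, hence are identified with their edge sets; the
   sequence [c] lists the vertices in cyclic order.  [2 < size c] excludes
   traversing a single edge back and forth, which [ucycle] allows. *)
Definition hamilton_cycle (X : sgraph) (C : {set {set X}}) : Prop :=
  exists c : seq X,
    [/\ ucycle (@adj X) c, 2 < size c, forall x : X, x \in c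
      & C = cycle_edges c].

(* Meaningful for k-valent [X].  [trivIset] says that distinct members of [D]
   are disjoint, i.e. that the cycles are pairwise edge-disjoint. *)
Definition hamilton_decomposition (k : nat) (X : sgraph)
    (D : {set {set {set X}}}) : Prop :=
  [/\ #|D| = k./2, forall C, C \in D -> hamilton_cycle C & trivIset D].

Section Cay.
Local Open Scope group_scope.
Variables (gT : finGroupType) (S : {set gT}).

Definition cay_adj : rel gT := fun g h => [exists s in S, h == g * s].

Hypotheses (S1 : 1 \notin S) (SV : {in S, forall s, s^-1 \in S}).

Lemma cay_adj_sym : symmetric cay_adj.
Proof.
suff H g h : cay_adj g h -> cay_adj h g by move=> g h; apply/idP/idP; apply: H.
case/exists_inP=> s sS /eqP->; apply/exists_inP; exists s^-1; first exact: SV.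
by rewrite mulgK.
Qed.

Lemma cay_adj_irrefl : irreflexive cay_adj.
Proof.
move=> g; apply/negbTE/exists_inP=> -[s sS].
by rewrite -{1}[g]mulg1 (inj_eq (mulgI g)) => /eqP s1; case/negP: (S1); rewrite s1.
Qed.

Definition Cay : sgraph := SGraph cay_adj_sym cay_adj_irrefl.

End Cay.

Definition cayley_graph (X : sgraph) : Prop :=
  exists (gT : finGroupType) (S : {set gT}) (S1 : 1%g \notin S)
         (SV : {in S, forall s, s^-1%g \in S}),
    graph_iso X (Cay S1 SV).

(* Main.v *)
Require Import Defs.
From mathcomp Require Import all_boot all_fingroup cyclic zify.

Set Implicit Arguments.
Unset Strict Implicit.
Unset Printing Implicit Defensive.

(** The graphs are thickenings of bipartite cubic coset graphs for which a
    one-factorization with three Hamiltonian unions is excluded by parity.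

    Take a finite group G generated by an element c of order 3 and an
    involution a, with a homomorphism to Z/2 that kills c but not a.  The cosets
    of <c>, with g<c> joined to ga<c>, form a cubic graph Q, bipartite through
    the homomorphism (and possibly with multiple edges).  In K x G, where K has
    order 2, let H = K x <c>; the connection set (H minus 1) together with (1, a) gives a 6-valent Cayley
    graph in which every coset of H is a copy of K_6 and every vertex has
    exactly one further edge, its outer edge.  Contracting the cosets of H
    yields Q with every edge doubled, because multiplication by K permutes the
    outer edges and preserves the blocks.

    Six outer edges leave a block, and each of the three edge-disjoint Hamilton
    cycles uses at least two of them, hence exactly two.  So outer edges get
    coloured by the cycles, each colour twice at every block.  The two parallel
    edges have different colours, since otherwise the cycle of that colour
    would never leave two blocks.  Giving each edge of Q the colour missing on
    its two copies, every colour becomes a perfect matching of Q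
    ([matchingK], [matching_flips]), and the cycle of colour C shows that the
    two matchings of the other colours are jointly transitive
    ([matching_transitive]).

    Let n be the number of blocks on one side of Q.  Following two of the
    matchings one after the other permutes that side as one n-cycle, of sign
    (-1)^(n-1).  The three permutations obtained from the three pairs of
    matchings compose to the identity, so n is odd
    ([odd_side_of_perfect_matchings]).  As the graph has 12n vertices, no
    decomposition exists as soon as 12 divides the order of G.

    For G we take the group generated by two permutations of 12(m+1) points: c
    rotates consecutive triples and a links each triple to the following one by
    a transposition.  There are 4m+3 links, so a is odd while c is even, and G
    is transitive, so 12(m+1) divides its order.  These orders are unbounded,
    which yields infinitely many isomorphism classes. *)

(** * Parity of perfect one-factorizations of bipartite graphs *)

(** With one orbit O and all else fixed there are 1 + |T| - |O| orbits, and the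
    sign is the parity of |T| plus the number of orbits. *)
Lemma odd_perm_single_cycle (T : finType) (p : {perm T}) (x : T) :
    (forall y, p y != y -> y \in porbit p x) ->
  odd_perm p = ~~ odd #|porbit p x|.
Proof.
move=> moved; set O := porbit p x in moved *.
have fixed y : y \notin O -> porbit p y = [set y].
  move=> yO; have py: p y = y by apply/eqP; apply: contraNT yO; apply: moved.
  apply/setP=> z; rewrite inE; apply/porbitP/eqP=> [[i ->]|->].
    by rewrite permX iter_fix.
  by exists 0; rewrite expg0 perm1.
have orbitsE : porbits p = O |: [set [set y] | y in ~: O].
  apply/setP=> B; rewrite !inE; apply/imsetP/orP.
    case=> y _ ->; have [yO|yO] := boolP (y \in O).
      by left; rewrite eq_porbit_mem.
    by right; rewrite fixed //; apply: imset_f; rewrite inE.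
  case=> [/eqP->|/imsetP[y]]; first by exists x.
  by rewrite inE => yO ->; exists y; rewrite ?fixed.
have newO : O \notin [set [set y] | y in ~: O].
  apply/imsetP=> -[y]; rewrite inE => /negP yO Oy; apply: yO.
  by rewrite Oy set11.
rewrite /odd_perm orbitsE cardsU1 newO card_imset; last exact: set1_inj.
by rewrite -(cardsC O) !oddD /=; do 2!case: (odd _).
Qed.

Section Matchings.

Variables (V : finType) (side : pred V).
Implicit Types m : V -> V.

Definition flips m := forall v, side (m v) = ~~ side v.

(** Connectedness of the union of the two matchings, phrased through invariant
    sets so that any walk whose steps are covered by the matchings proves it. *)
Definition jointly_transitive m m' :=
  forall P : pred V, (forall v, P v -> P (m v) && P (m' v)) ->
  forall u v, P u -> P v.

(** Two steps, along m and then m', bring a vertex back to its own side.  The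
    other side is frozen: on the whole of V the permutation would have two cycles
    of equal length, and its sign would carry no information. *)
Definition alternate m m' v := if side v then m' (m v) else v.

Lemma alternate_inj m m' : involutive m -> involutive m' ->
  flips m -> flips m' -> injective (alternate m m').
Proof.
move=> mK m'K sm sm' u v; rewrite /alternate.
case: ifP => su; case: ifP => sv //.
- by move/(can_inj m'K)/(can_inj mK).
- by move=> e; move: sv; rewrite -e sm' sm su.
- by move=> e; move: su; rewrite e sm' sm sv.
Qed.

(** The group generated by the two matchings is dihedral: the even words are the
    powers of p, the odd ones change sides, so transitivity on V makes p
    transitive on a side.  In the proof, R is the union of the p-orbit O of v
    with the set m O, and it is invariant under both matchings. *)
Lemma alternate_orbit m m' (p : {perm V}) v : involutive m -> involutive m' ->
    flips m -> flips m' -> jointly_transitive m m' -> p =1 alternate m m' ->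
  side v -> porbit p v = [set u | side u].
Proof.
move=> mK m'K sm sm' tr pE sv; set O := porbit p v.
have sO u : u \in O -> side u.
  case/porbitP=> i ->; rewrite permX; elim: i => //= i IHi.
  by rewrite pE /alternate IHi sm' sm IHi.
have pO u : (p u \in O) = (u \in O).
  by have := porbit_perm p 1 u; rewrite expg1 /O -!eq_porbit_mem => ->.
pose R u := (u \in O) || (m u \in O).
have RT u : R u.
  apply: (tr R) (_ : R v); last by rewrite /R porbit_id.
  move=> w /orP[wO|mwO]; rewrite /R mK; last rewrite mwO /=.
    rewrite wO orbT /=; apply/orP; right.
    by rewrite -pO pE /alternate sm sm' mK m'K negbK sO.
  have := mwO; rewrite -pO pE /alternate (sO _ mwO) mK => ->.
  by [].
apply/setP=> u; rewrite inE; apply/idP/idP; first exact: sO.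
move=> su; case/orP: (RT u) => // /sO; by rewrite sm su.
Qed.

(** Kotzig's parity argument: the three alternating permutations compose to the
    identity, and each is a single cycle on the side, so a product of three
    equal signs is +1, which makes n-cycles even and n odd. *)
Lemma odd_side_of_perfect_matchings m0 m1 m2 (v0 : V) :
    involutive m0 -> involutive m1 -> involutive m2 ->
    flips m0 -> flips m1 -> flips m2 ->
    jointly_transitive m0 m1 -> jointly_transitive m1 m2 ->
    jointly_transitive m2 m0 ->
  odd #|[set v | side v]|.
Proof.
move=> m0K m1K m2K s0 s1 s2 tr01 tr12 tr20.
have [v sv] : exists v, side v.
  by case sv: (side v0); [exists v0 | exists (m0 v0); rewrite s0 sv].
pose p01 := perm (alternate_inj m0K m1K s0 s1).
pose p12 := perm (alternate_inj m1K m2K s1 s2).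
pose p20 := perm (alternate_inj m2K m0K s2 s0).
have p1 : (p01 * p12 * p20 = 1)%g.
  apply/permP=> u; rewrite !permM !permE /alternate.
  case su: (side u); rewrite /= ?su //= s1 s0 su /= m1K s2 s0 su /=.
  by rewrite m2K m0K.
have sgn m m' (p : {perm V}) : involutive m -> involutive m' ->
    flips m -> flips m' -> jointly_transitive m m' -> p =1 alternate m m' ->
    odd_perm p = ~~ odd #|[set u | side u]|.
  move=> mK m'K sm sm' tr pE.
  have orb := alternate_orbit mK m'K sm sm' tr pE sv.
  rewrite -orb; apply: odd_perm_single_cycle => y; rewrite orb inE pE /alternate.
  by case: ifP; rewrite ?eqxx.
have := odd_perm1 V; rewrite -p1 !odd_permM.
have -> := sgn m0 m1 p01 m0K m1K s0 s1 tr01 (permE _).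
have -> := sgn m1 m2 p12 m1K m2K s1 s2 tr12 (permE _).
have -> := sgn m2 m0 p20 m2K m0K s2 s0 tr20 (permE _).
by case: (odd _).
Qed.

End Matchings.

(** * Hamilton decompositions of graphs made of 6-vertex blocks *)

(** A Hamilton cycle cannot be confined to a proper set of vertices; every use of
    Hamiltonicity below goes through this exit step. *)
Lemma cycle_leaves (T : finType) (c : seq T) (P : pred T) x y : uniq c ->
    x \in c -> P x -> y \in c -> ~~ P y ->
  exists2 z, z \in c & P z && ~~ P (next c z).
Proof.
move=> Uc xc Px yc Py; apply/exists_inP; apply: contraT => stay.
have: fconnect (next c) x y by rewrite (fconnect_cycle (cycle_next Uc) xc).
move/iter_findex; move: (findex _ x y) => n yE; case/negP: Py; rewrite -yE.
have : (iter n (next c) x \in c) && P (iter n (next c) x).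
  elim: n {yE} => [|n /andP[nc Pn]] /=; first by rewrite xc.
  rewrite mem_next nc /=; apply: contraNT stay => Pn'.
  by apply/exists_inP; exists (iter n (next c) x); rewrite ?Pn.
by case/andP.
Qed.

Section BlockGraph.

Variables (X : sgraph) (V : finType) (b : X -> V) (side : pred V) (a t : X -> X).

(** Here b sends a vertex to its block, x and a x are the ends of the outer edge
    at x, and t exchanges the two outer edges that join the same two blocks. *)
Hypothesis block_card : forall v, #|[set x | b x == v]| = 6.
Hypothesis adj_block : forall x y : X, adj x y -> b x = b y \/ y = a x.
Hypotheses (aK : involutive a) (tK : involutive t) (atC : forall x, a (t x) = t (a x)).
Hypotheses (t_fixfree : forall x, t x != x) (b_t : forall x, b (t x) = b x).
Hypothesis side_a : forall x, side (b (a x)) = ~~ side (b x).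
Hypothesis manyX : 12 < #|X|.

Lemma block_inhabited v : exists x, b x = v.
Proof.
have /card_gt0P[x] : 0 < #|[set x | b x == v]| by rewrite block_card.
by rewrite inE => /eqP; exists x.
Qed.

Lemma card_blocks : #|X| = #|V| * 6.
Proof.
rewrite -sum_nat_const -sum1_card (partition_big b predT) //=.
apply: eq_bigr => v _.
by rewrite -(block_card v) -sum1_card; apply: eq_bigl => x; rewrite inE.
Qed.

Lemma many_blocks : 2 < #|V|.
Proof. by move: manyX; rewrite card_blocks; lia. Qed.

(** The cycle leaves the block through the outer edge at z1 and enters it at the
    successor of z2.  If these two vertices were equal, the cycle would go back
    along the edge it came from and have length 2. *)
Lemma hamilton_crosses_twice C v : hamilton_cycle C ->
  2 <= #|[set x | (b x == v) && ([set x; a x] \in C)]|.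
Proof.
case=> c [/andP[cyc Uc] c3 cT CE].
have inC z : [set z; next c z] \in C by rewrite CE; apply: imset_f.
have step z : b z != b (next c z) -> next c z = a z.
  by have [->|//] := adj_block (next_cycle cyc (cT z)); rewrite eqxx.
have [x xv] := block_inhabited v.
have [y yv] : exists y, b y != v.
  by exists (a x); apply/eqP=> e; move: (side_a x); rewrite e xv; case: (side v).
have [z1 _ /andP[/eqP z1v z1v']] :=
  @cycle_leaves _ c (fun z => b z == v) x y Uc (cT x) (introT eqP xv) (cT y) yv.
have [|z2 _ /andP[z2v /negPn/eqP z2v']] :=
  @cycle_leaves _ c (fun z => b z != v) y x Uc (cT y) yv (cT x).
  by rewrite negbK xv.
have n1 : next c z1 = a z1 by apply: step; rewrite z1v eq_sym.
have n2 : next c z2 = a z2 by apply: step; rewrite z2v'.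
apply/card_gt1P; exists z1, (next c z2); rewrite !inE z1v z2v' eqxx /=; split.
- by rewrite -n1 inC.
- by rewrite {2}n2 aK setUC inC.
apply/eqP=> z12.
have n3 : next c z1 = z2 by rewrite n1 z12 n2 aK.
have [w wc /norP[w1 w2]] : exists2 w, w \in c & ~~ ((w == z1) || (w == z2)).
  apply/exists_inP; apply: contraTT c3 => /exists_inPn small.
  rewrite -leqNgt; apply: (@uniq_leq_size _ c [:: z1; z2]) => // w /small.
  by rewrite negbK !inE.
have [||u _ /andP[]] := @cycle_leaves _ c (pred2 z1 z2) z1 w Uc (cT z1) _ wc.
- by rewrite /= eqxx.
- by rewrite /= negb_or w1.
by case/pred2P=> ->; rewrite /= ?n3 -?z12 eqxx ?orbT.
Qed.

Variable D : {set {set {set X}}}.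
Hypothesis decD : hamilton_decomposition 6 D.

(** The cycle of D that contains the outer edge at x; it is unique because D is
    disjoint, and [colour_in] shows that it exists. *)
Definition colour (x : X) : {set {set X}} := pblock D [set x; a x].

Lemma colour_edge C x : C \in D -> [set x; a x] \in C -> colour x = C.
Proof. by move=> CD xC; case: decD => _ _ tI; apply: def_pblock. Qed.

Lemma colour_a x : colour (a x) = colour x.
Proof. by rewrite /colour aK setUC. Qed.

Definition coloured C v := [set x | (b x == v) && (colour x == C)].

Lemma coloured_ge2 C v : C \in D -> 2 <= #|coloured C v|.
Proof.
move=> CD; case: decD => _ hD _; apply: leq_trans (hamilton_crosses_twice v (hD _ CD)) _.
apply: subset_leq_card; apply/subsetP=> x; rewrite !inE => /andP[-> xC] /=.
by rewrite (colour_edge CD xC).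
Qed.

Lemma colour_count v :
  #|[set x | (b x == v) && (colour x \notin D)]| + \sum_(C in D) #|coloured C v| = 6.
Proof.
rewrite -(block_card v) -[RHS](cardsID [set x | colour x \in D]) addnC; congr (_ + _).
  symmetry.
  rewrite -sum1_card (partition_big colour (mem D)) /=; last first.
    by move=> x; rewrite !inE => /andP[].
  apply: eq_bigr => C CD; rewrite -sum1_card; apply: eq_bigl => x.
  by rewrite !inE -andbA; case: (colour x =P C) => [->|]; rewrite ?CD ?andbF.
by apply: eq_card => x; rewrite !inE andbC.
Qed.

(** Three disjoint sets of size at least 2 already fill the 6 vertices of the
    block. *)
Lemma colour_in x : colour x \in D.
Proof.
have cnt := colour_count (b x); have [D3 _ _] := decD.
have : \sum_(C in D) 2 <= \sum_(C in D) #|coloured C (b x)|.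
  by apply: leq_sum => C; apply: coloured_ge2.
rewrite sum_nat_const D3 => ge6.
have /eqP : #|[set y | (b y == b x) && (colour y \notin D)]| = 0 by lia.
rewrite cards_eq0 => /eqP/setP/(_ x); rewrite !inE eqxx /=.
by move/negbFE.
Qed.

Lemma card_coloured C v : C \in D -> #|coloured C v| = 2.
Proof.
move=> CD; have cnt := colour_count v; have [D3 _ _] := decD.
have : \sum_(C' in D | C' != C) 2 <= \sum_(C' in D | C' != C) #|coloured C' v|.
  by apply: leq_sum => C' /andP[C'D _]; apply: coloured_ge2.
rewrite sum_nat_const; have -> : #|[pred C' in D | C' != C]| = 2.
  move: D3; rewrite (cardsD1 C) CD => -[<-]; apply: eq_card => C'.
  by rewrite !inE andbC.
move: cnt (coloured_ge2 v CD); rewrite (bigD1 C) //=; lia.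
Qed.

(** A Hamilton cycle visits every block and changes block only along outer edges
    of its own colour. *)
Lemma colour_walk C : C \in D -> forall P : pred V,
    (forall x, colour x = C -> P (b x) -> P (b (a x))) ->
  forall u v, P u -> P v.
Proof.
move=> CD P clP u v Pu; apply: contraT => Pv.
case: decD => _ /(_ _ CD) [c [/andP[cyc Uc] c3 cT CE]] _.
have [[x xu] [y yv]] := (block_inhabited u, block_inhabited v).
have [||z zc /andP[]] := @cycle_leaves _ c (fun z => P (b z)) x y Uc (cT x) _ (cT y).
- by rewrite xu.
- by rewrite yv.
have [->|nz] := adj_block (next_cycle cyc zc); first by move->.
move=> Pz; rewrite nz clP //; apply: colour_edge => //.
by rewrite -nz CE; apply: imset_f.
Qed.

(** If both edges between two blocks had colour C, they would be all the edges of
    colour C at these two blocks, and the cycle C could visit no other block. *)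
Lemma colour_t x : colour (t x) != colour x.
Proof.
apply/eqP=> cxt; set C := colour x in cxt.
have CD : C \in D by apply: colour_in.
have two z : colour z = C -> colour (t z) = C -> coloured C (b z) = [set z; t z].
  move=> cz ctz; apply/eqP; rewrite eq_sym eqEcard card_coloured // cards2.
  rewrite eq_sym t_fixfree andbT; apply/subsetP=> y /set2P[]->;
  by rewrite inE ?b_t ?cz ?ctz !eqxx.
pose P v := (v == b x) || (v == b (a x)).
have PT v : P v.
  apply: (colour_walk CD) (_ : P (b x)); last by rewrite /P eqxx.
  move=> y cy /pred2P[] yx; have : y \in coloured C (b y) by rewrite inE cy !eqxx.
    by rewrite yx two // => /set2P[]->; rewrite /P ?atC ?b_t eqxx orbT.
  rewrite yx two ?colour_a //; last by rewrite -atC colour_a.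
  by case/set2P=> ->; rewrite /P ?atC ?b_t ?aK eqxx.
suff : #|V| <= 2 by rewrite leqNgt many_blocks.
apply: leq_trans (_ : #|[set b x; b (a x)]| <= 2); last by rewrite cards2 ltnS leq_b1.
by apply: subset_leq_card; apply/subsetP=> v _; rewrite !inE; apply: PT.
Qed.

(** The ends, in the block v, of the doubled edge that avoids the colour C. *)
Definition missing C v :=
  [set x | [&& b x == v, colour x != C & colour (t x) != C]].

(** The two vertices of colour C lie in different t-pairs by [colour_t], so these
    pairs cover 4 of the 6 vertices and exactly one pair remains. *)
Lemma card_missing C v : C \in D -> #|missing C v| = 2.
Proof.
move=> CD; pose K := coloured C v.
have missE : missing C v = [set x | b x == v] :\: (K :|: t @: K).
  apply/setP=> x; rewrite !inE (can_imset_pre _ tK) !inE b_t.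
  by case: eqP => //=; rewrite ?andbF //= andbT negb_or.
have sub : K :|: t @: K \subset [set x | b x == v].
  apply/subsetP=> x; rewrite !inE (can_imset_pre _ tK) !inE b_t.
  by case/orP=> /andP[].
have dis : [disjoint K & t @: K].
  rewrite -setI_eq0; apply/eqP/setP=> x; rewrite !inE (can_imset_pre _ tK) !inE.
  apply/negP=> /andP[/andP[_ /eqP xC] /andP[_ /eqP txC]].
  by move: (colour_t x); rewrite txC xC eqxx.
rewrite missE cardsD (setIidPr sub) block_card cardsU.
rewrite (eqP (_ : K :&: t @: K == set0)) ?setI_eq0 // cards0.
by rewrite card_imset ?card_coloured //; apply: can_inj tK.
Qed.

(** The default v is never reached for C in D, by [card_missing]. *)
Definition matching C v := if [pick x in missing C v] is Some x then b (a x) else v.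

Lemma matchingE C x : C \in D -> colour x != C -> colour (t x) != C ->
  matching C (b x) = b (a x).
Proof.
move=> CD xC txC.
have missE : missing C (b x) = [set x; t x].
  apply/eqP; rewrite eq_sym eqEcard card_missing // cards2.
  rewrite eq_sym t_fixfree andbT; apply/subsetP=> y /set2P[]->;
  by rewrite inE ?b_t ?tK ?xC ?txC eqxx.
rewrite /matching; case: pickP => [y|/(_ x)]; rewrite missE.
  by case/set2P=> ->; rewrite ?atC ?b_t.
by rewrite set21.
Qed.

Lemma matching_edge C v : C \in D ->
  exists x, [/\ b x = v, colour x != C & colour (t x) != C].
Proof.
move=> CD; have /card_gt0P[x] : 0 < #|missing C v| by rewrite card_missing.
by rewrite inE => /and3P[/eqP <- xC txC]; exists x.
Qed.

Lemma matchingK C : C \in D -> involutive (matching C).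
Proof.
move=> CD v; have [x [<- xC txC]] := matching_edge v CD.
rewrite (matchingE CD xC txC) matchingE ?aK ?colour_a //.
by rewrite -atC colour_a.
Qed.

Lemma matching_flips C : C \in D -> flips side (matching C).
Proof.
move=> CD v; have [x [<- xC txC]] := matching_edge v CD.
by rewrite matchingE // side_a.
Qed.

(** A step of the cycle C between blocks uses a doubled edge with colours C and,
    say, C1; its missing colour is then C2, so the step is a step of the matching
    of C2. *)
Lemma matching_transitive C C1 C2 : D = [set C; C1; C2] ->
  jointly_transitive (matching C1) (matching C2).
Proof.
move=> DE P clP.
have [CD C1D C2D] : [/\ C \in D, C1 \in D & C2 \in D] by rewrite DE !inE !eqxx ?orbT.
have [D3 _ _] := decD.
have [CC1 CC2 C12] : [/\ C != C1, C != C2 & C1 != C2].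
  by move: D3; rewrite DE -setUA !cardsU1 cards1 !inE;
    do 3![case: (_ == _)] => //.
apply: (colour_walk CD) => x xC /clP/andP[P1 P2].
have /[!DE] := colour_in (t x); rewrite !inE.
move: (colour_t x); rewrite xC => /negPf-> /= /orP[]/eqP txC.
  by rewrite -(@matchingE C2) ?xC ?txC.
by rewrite -(@matchingE C1) ?xC ?txC // eq_sym.
Qed.

(** Each block has 6 vertices and the two sides have n blocks each, exchanged by
    any of the matchings. *)
Lemma odd_blocks : exists2 n, odd n & #|X| = 12 * n.
Proof.
have [D3 _ _] := decD.
have [C0 [C1 [C2 DE]]] : exists C0 C1 C2, D = [set C0; C1; C2].
  have /card_gt0P[C0 C0D] : 0 < #|D| by rewrite D3.
  move: D3; rewrite (cardsD1 C0) C0D => -[] /eqP/cards2P[C1 [C2 [_ E]]].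
  by exists C0, C1, C2; rewrite -setUA -E setD1K.
have [C0D C1D C2D] : [/\ C0 \in D, C1 \in D & C2 \in D] by rewrite DE !inE !eqxx ?orbT.
have [v0 _] : exists v0 : V, v0 \in V by apply/card_gt0P; apply: leq_trans many_blocks.
exists #|[set v | side v]|.
  apply: (@odd_side_of_perfect_matchings _ _
    (matching C0) (matching C1) (matching C2) v0);
    try exact: matchingK; try exact: matching_flips.
  - by apply: (@matching_transitive C2); rewrite DE setUC setUA.
  - exact: (@matching_transitive C0).
  - by apply: (@matching_transitive C1); rewrite DE -setUA setUC.
rewrite card_blocks -(cardsC [set v | side v]).
have -> : ~: [set v | side v] = matching C0 @: [set v | side v].
  apply/setP=> v; rewrite (can_imset_pre _ (matchingK C0D)) !inE.
  by rewrite matching_flips.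
rewrite card_imset; last exact: can_inj (matchingK C0D).
lia.
Qed.

End BlockGraph.

(** * Cayley graphs with blocks K_6 over cubic coset graphs *)

Section CayleyBlocks.
Local Open Scope group_scope.

(** The right translations that stay within every connected component form a
    subgroup. *)
Lemma connected_Cay (gT : finGroupType) (S : {set gT}) S1 SV :
  <<S>> = [set: gT] -> connected_graph (@Cay gT S S1 SV).
Proof.
move=> genS; split; first by apply/card_gt0P; exists (1 : gT).
pose R := [set s | [forall x, connect (cay_adj S) x (x * s)]].
have groupR : group_set R.
  apply/group_setP; split=> [|s u].
    by rewrite inE; apply/forallP=> x; rewrite mulg1 connect0.
  rewrite !inE => /forallP sR /forallP uR; apply/forallP=> x.
  by rewrite mulgA; apply: connect_trans (sR x) (uR _).
have SR : <<S>> \subset Group groupR.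
  rewrite gen_subG; apply/subsetP=> s sS; rewrite inE; apply/forallP=> x.
  by apply/connect1/exists_inP; exists s.
move=> x y; have : x^-1 * y \in <<S>> by rewrite genS inE.
by move/(subsetP SR); rewrite inE => /forallP/(_ x); rewrite mulKVg.
Qed.

Lemma valent_Cay (gT : finGroupType) (S : {set gT}) S1 SV :
  valent #|S| (@Cay gT S S1 SV).
Proof.
move=> x; rewrite -(card_lcoset S x); apply: eq_card => y; rewrite inE.
apply/exists_inP/lcosetP=> [[s sS /eqP->]|[s sS ->]]; by exists s.
Qed.

Variables (K gT : finGroupType) (k : K) (c a : gT) (sg : gT -> bool).
Hypotheses (K2 : #|K| = 2) (k1 : k != 1).
Hypotheses (c3 : #[c] = 3) (a2 : a * a = 1) (gen_ca : <<[set c; a]>> = [set: gT]).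
Hypotheses (sgM : {morph sg : x y / x * y >-> x (+) y}) (sg_c : ~~ sg c) (sg_a : sg a).

(** A cyclic group of order 6 whose left cosets induce copies of K_6. *)
Definition block : {set K * gT} := setX [set: K] <[c]>.
Definition connection_set : {set K * gT} := (1, a) |: block^#.

Lemma sg_cycle x : x \in <[c]> -> sg x = false.
Proof.
have sg1 : sg 1 = false by have := sgM 1 1; rewrite mulg1; case: (sg 1).
case/cycleP=> i ->; elim: i => [|i IHi]; first by rewrite expg0.
by rewrite expgS sgM IHi (negPf sg_c).
Qed.

(** Hence (1, a) is not in the block subgroup: the outer edges do leave the
    blocks. *)
Lemma a_notin_cycle : a \notin <[c]>.
Proof. by apply: contraL sg_a => /sg_cycle->. Qed.

Lemma connection_set1 : 1 \notin connection_set.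
Proof.
rewrite !inE eqxx orbF; apply: contra a_notin_cycle => /eqP[<-].
exact: group1.
Qed.

Lemma connection_setV : {in connection_set, forall s, s^-1 \in connection_set}.
Proof.
move=> s /setU1P[->|].
  apply/setU1P; left; congr (_, _); rewrite /= ?invg1 //.
  by apply/eqP; rewrite eq_invg_mul a2.
case/setD1P=> s1 sH; apply/setU1P; right; apply/setD1P.
by rewrite invg_eq1 s1 (groupVr sH).
Qed.

Definition block_graph : sgraph := Cay connection_set1 connection_setV.

Lemma card_block_graph : #|block_graph| = (2 * #|gT|)%N.
Proof. by rewrite -K2 -card_prod. Qed.

Lemma cayley_block_graph : cayley_graph block_graph.
Proof.
exists (K * gT)%type, connection_set, connection_set1, connection_setV.
by exists id; split=> //; exists id.
Qed.

Lemma valent_block_graph : valent 6 block_graph.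
Proof.
have <- : #|connection_set| = 6; last exact: valent_Cay.
rewrite cardsU1 !inE (negPf a_notin_cycle) !andbF /=.
have := cardsD1 1 block; rewrite (group1 [group of block]) cardsX cardsT K2.
by rewrite -orderE c3 => /eqP; rewrite eqSS => /eqP <-.
Qed.

Lemma connected_block_graph : connected_graph block_graph.
Proof.
apply: connected_Cay; apply/eqP; rewrite eqEsubset subsetT /=.
have blockW x : x \in block -> x \in <<connection_set>>.
  have [->|x1 xB] := eqVneq x 1; first by rewrite group1.
  by apply: mem_gen; rewrite inE in_setD1 x1 xB orbT.
apply/subsetP=> -[u g] _.
have -> : (u, g) = (u, 1) * (1, g) by rewrite -[u in LHS]mulg1 -[g in LHS]mul1g.
apply: groupM; first by apply: blockW; rewrite !inE group1.
suff /subsetP/(_ g) : [set: gT] \subset @pair1g K gT @*^-1 <<connection_set>>.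
  by rewrite inE => /(_ isT)/morphpreP[].
rewrite -{1}gen_ca gen_subG; apply/subsetP=> x /set2P[]->; rewrite !inE /=.
  by apply: blockW; rewrite !inE cycle_id.
by apply: mem_gen; rewrite setU11.
Qed.

(** Blocks are indexed by the cosets of <[c]> in gT, since K lies in the block
    subgroup; as (k, 1) is central, translation by it keeps each block and
    commutes with translation by (1, a).  The vertex count 12n with n odd
    contradicts 24 dividing 2|gT|. *)
Lemma block_graph_no_decomposition : 12 %| #|gT| ->
  ~ exists D : {set {set {set block_graph}}}, hamilton_decomposition 6 D.
Proof.
move=> div12 [D decD].
pose V := {B : {set gT} | B \in lcosets <[c]> [set: gT]}.
have inV (x : block_graph) : x.2 *: <[c]> \in lcosets <[c]> [set: gT].
  by apply/lcosetsP; exists x.2.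
pose b (x : block_graph) : V := Sub (x.2 *: <[c]>) (inV x).
have bE (x y : block_graph) : (b x == b y) = (y.2 \in x.2 *: <[c]>).
  by rewrite -val_eqE /=; apply/eqP/lcoset_eqP.
have gt0 : 0 < #|gT| by apply/card_gt0P; exists 1.
have block_card v : #|[set x | b x == v]| = 6.
  case: v => B BV; have [g _ BE] := lcosetsP BV.
  suff -> : [set x | b x == exist _ B BV] = setX [set: K] (g *: <[c]>).
    by rewrite cardsX cardsT K2 card_lcoset -orderE c3.
  apply/setP=> x; rewrite !inE -val_eqE /= BE.
  by apply/eqP/idP=> /lcoset_eqP.
have adj_block (x y : block_graph) :
    adj x y -> b x = b y \/ y = (x : K * gT) * (1, a).
  case/exists_inP=> s /setU1P[->|/setD1P[_ sH]] /eqP->; [by right | left].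
  apply/eqP; rewrite bE /= mem_lcoset mulKg.
  by move: sH; rewrite inE => /andP[].
have aK : involutive (fun x : block_graph => (x : K * gT) * (1, a) : block_graph).
  move=> x; rewrite -mulgA [_ * (1, a)](_ : _ = 1) ?mulg1 //.
  by congr (_, _); rewrite ?mulg1.
have kk : k * k = 1.
  by have := expg_cardG (in_setT k); rewrite cardsT K2.
have tK : involutive (fun x : block_graph => (x : K * gT) * (k, 1) : block_graph).
  move=> x; rewrite -mulgA [_ * (k, 1)](_ : _ = 1) ?mulg1 //.
  by congr (_, _); rewrite ?mulg1.
have sgb x : sg (repr (val (b x))) = sg x.2.
  have /lcosetP[d dC ->] : repr (x.2 *: <[c]>) \in x.2 *: <[c]>.
    exact: mem_repr (lcoset_refl _ x.2).
  by rewrite sgM (sg_cycle dC) addbF.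
have [|||||n odd_n] := @odd_blocks block_graph V b (fun v => sg (repr (val v))) _ _
   block_card adj_block aK tK _ _ _ _ _ D decD.
- by move=> x; rewrite -!mulgA; congr (_ * _); congr (_, _); rewrite /= ?mulg1 ?mul1g.
- by move=> x; rewrite -[X in _ != X]mulg1 (inj_eq (mulgI _)) xpair_eqE negb_and k1.
- by move=> x; apply/eqP; rewrite bE /= mem_lcoset invMg invg1 mul1g mulVg group1.
- by move=> x; rewrite !sgb /= sgM sg_a addbT.
- by rewrite card_block_graph; move: div12 gt0; lia.
by rewrite card_block_graph; move: div12 odd_n; lia.
Qed.
End CayleyBlocks.

(** * A family of groups generated by elements of orders 3 and 2 *)

Section PermutationGroup.
Local Open Scope group_scope.

Variable m : nat.
(** The number of points is written as a successor so that ord0 and inord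
    apply; it equals 12(m+1). *)
Notation point := 'I_(12 * m + 11).+1.

Definition rotation_fun (x : point) : point :=
  inord (if x %% 3 == 2 then x - 2 else x.+1).

Lemma rotation_funE (x : point) :
  rotation_fun x = (if x %% 3 == 2 then x - 2 else x.+1) :> nat.
Proof. by rewrite inordK //; case: x => x /=; case: eqP; lia. Qed.

Lemma rotation_inj : injective rotation_fun.
Proof.
move=> x y /(congr1 (@nat_of_ord _)); rewrite !rotation_funE => e; apply: ord_inj.
by move: e; do 2![case: eqP]; lia.
Qed.

Definition rotation : {perm point} := perm rotation_inj.

(** The transpositions joining the last point of a triple to the first point of
    the next one; n is kept general for induction. *)
Definition links (n : nat) : {perm point} :=
  \prod_(i < n) tperm (inord (3 * i + 2)) (inord (3 * i + 3)).

Definition linking := links (4 * m + 3).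

Lemma linksS n :
  links n.+1 = links n * tperm (inord (3 * n + 2)) (inord (3 * n + 3)).
Proof. by rewrite /links big_ord_recr. Qed.

Lemma linksE n (x : point) : n <= 4 * m + 3 ->
  links n x = (if (x %% 3 == 2) && (x < 3 * n) then x.+1
               else if (x %% 3 == 0) && (0 < x <= 3 * n) then x.-1 else x) :> nat.
Proof.
elim: n => [|n IHn] le_n.
  by rewrite /links big_ord0 perm1; do ?[case: ifP]; lia.
move: (IHn (ltnW le_n)); rewrite linksS permM.
move: (links n x) => y yE.
case: tpermP => [yy|yy|].
- by move: yE; rewrite yy !inordK; do ?[case: ifP]; lia.
- by move: yE; rewrite yy !inordK; do ?[case: ifP]; lia.
move=> /eqP; rewrite -val_eqE /= inordK; last by lia.
move=> n1 /eqP; rewrite -val_eqE /= inordK; last by lia.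
by move: yE n1; do ?[case: ifP]; lia.
Qed.

Lemma odd_links n : n <= 4 * m + 3 -> odd_perm (links n) = odd n.
Proof.
elim: n => [|n IHn] le_n; first by rewrite /links big_ord0 odd_perm1.
rewrite linksS odd_permM IHn ?(ltnW le_n) // odd_tperm -val_eqE /= !inordK; lia.
Qed.

Definition triangle_group : {group {perm point}} := <<[set rotation; linking]>>.

Lemma rotation_in : rotation \in triangle_group.
Proof. by rewrite mem_gen ?set21. Qed.

Lemma linking_in : linking \in triangle_group.
Proof. by rewrite mem_gen ?set22. Qed.

Lemma order_rotation : #[rotation] = 3.
Proof.
apply: nt_prime_order => //.
  apply/permP=> x; apply: ord_inj; rewrite !permM !permE !rotation_funE.
  by do ?[case: ifP]; lia.
apply/eqP=> /permP/(_ ord0)/(congr1 (@nat_of_ord _)).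
by rewrite perm1 permE rotation_funE.
Qed.

Lemma linking2 : linking * linking = 1.
Proof.
apply/permP=> x; apply: ord_inj; rewrite permM perm1 !linksE //.
by do ?[case: ifP]; lia.
Qed.

(** A point goes to its successor by the linking permutation at the end of a triple
    and by the rotation inside one. *)
Lemma triangle_group_transitive (x : point) : x \in orbit 'P triangle_group ord0.
Proof.
case: x; elim=> [|n IHn] lt_n.
  by rewrite (_ : Ordinal _ = ord0) ?orbit_refl //; apply: ord_inj.
apply: orbit_trans (IHn (ltnW lt_n)).
have [n3|n3] := eqVneq (n %% 3) 2.
  rewrite (_ : Ordinal _ = 'P%act (Ordinal (ltnW lt_n)) linking).
    exact: mem_orbit linking_in.
  apply: ord_inj; rewrite /= linksE //= n3 /=; case: ifP; lia.
rewrite (_ : Ordinal _ = 'P%act (Ordinal (ltnW lt_n)) rotation).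
  exact: mem_orbit rotation_in.
by apply: ord_inj; rewrite /= /aperm permE rotation_funE /= (negPf n3).
Qed.

Lemma card_triangle_group : (12 * m.+1)%N %| #|triangle_group|.
Proof.
have <- : #|orbit 'P triangle_group (ord0 : point)| = (12 * m.+1)%N.
  rewrite -[RHS](_ : #|point| = _); last by rewrite card_ord; lia.
  by apply: eq_card => x; rewrite triangle_group_transitive.
exact: dvdn_orbit.
Qed.

Notation G := [subg triangle_group]%type.
Definition rot : G := subg _ rotation.
Definition link : G := subg _ linking.
Definition parity (x : G) : bool := odd_perm (sgval x).

Lemma order_rot : #[rot] = 3.
Proof.
apply: etrans order_rotation.
exact: order_injm (injm_subg _) _ rotation_in.
Qed.

Lemma link2 : link * link = 1.
Proof. by apply: val_inj; rewrite /= [sgval _]subgK ?linking_in // linking2. Qed.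

Lemma gen_rot_link : <<[set rot; link]>> = [set: G].
Proof.
apply/eqP; rewrite eqEsubset subsetT /=; apply/subsetP=> x _.
have sub : triangle_group \subset sgval @* <<[set rot; link]>>.
  rewrite gen_subG; apply/subsetP=> y /set2P[]->.
    rewrite -(subgK _ rotation_in); apply: mem_morphim; rewrite ?inE //.
    by apply: mem_gen; rewrite set21.
  rewrite -(subgK _ linking_in); apply: mem_morphim; rewrite ?inE //.
  by apply: mem_gen; rewrite set22.
have /morphimP[y _ yW /val_inj->] := subsetP sub _ (subgP x).
exact: yW.
Qed.

Lemma parityM : {morph parity : x y / x * y >-> x (+) y}.
Proof. by move=> x y; rewrite /parity odd_permM. Qed.

(** An element of order 3 is in the kernel of any homomorphism to Z/2. *)
Lemma parity_rot : ~~ parity rot.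
Proof.
have := parityM rot (rot * rot); rewrite [in RHS](parityM rot rot).
have -> : rot * (rot * rot) = 1 by rewrite -(expg_order rot) order_rot !expgS expg0 mulg1.
by rewrite /parity odd_perm1; case: (odd_perm _).
Qed.

Lemma parity_link : parity link.
Proof. by rewrite /parity [sgval _]subgK ?linking_in // odd_links //; lia. Qed.

Lemma card_G : (12 * m.+1)%N %| #|G|.
Proof.
suff -> : #|G| = #|triangle_group| by exact: card_triangle_group.
by rewrite -cardsT (isom_card (isom_sgval triangle_group)).
Qed.

End PermutationGroup.


(** * The graphs, spaced out by their orders *)
Definition graph_family (m : nat) : sgraph :=
  block_graph {perm 'I_2} (link2 m) (@parityM m) (parity_rot m) (parity_link m).

Lemma card_graph_family m : m < #|graph_family m|.
Proof.
rewrite card_block_graph; last by rewrite card_Sn.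
have gt0 : 0 < #|[subg triangle_group m]%type| by apply/card_gt0P; exists 1%g.
have le_m := dvdn_leq gt0 (card_G m).
apply: leq_trans (leq_trans _ le_m) (leq_pmull _ _) => //; lia.
Qed.

Lemma graph_familyP m :
  [/\ connected_graph (graph_family m), valent 6 (graph_family m),
      cayley_graph (graph_family m)
    & ~ exists D : {set {set {set graph_family m}}}, hamilton_decomposition 6 D].
Proof.
have K2 : #|{perm 'I_2}| = 2 by rewrite card_Sn.
split.
- exact: connected_block_graph _ (gen_rot_link m) _ _ _.
- exact: (@valent_block_graph _ _ _ _ _ K2 (order_rot m)).
- exact: cayley_block_graph.
have k1 : tperm ord0 ord_max != 1%g :> {perm 'I_2}.
  by apply/eqP=> /(congr1 (@odd_perm _)); rewrite odd_tperm odd_perm1.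
apply: (block_graph_no_decomposition K2 k1 (order_rot m)).
exact: dvdn_trans (dvdn_mulr _ (dvdnn _)) (card_G m).
Qed.

(** Since the graph of index m has more than m vertices, using the order of each
    graph as the next index makes the orders strictly increasing, without any
    monotonicity of the family itself. *)
Fixpoint spaced_index (i : nat) : nat :=
  if i is j.+1 then #|graph_family (spaced_index j)| else 0.

Lemma card_spaced i j : i < j ->
  #|graph_family (spaced_index i)| < #|graph_family (spaced_index j)|.
Proof.
elim: j => // j IHj; rewrite ltnS leq_eqVlt => /predU1P[->|/IHj lt_ij].
  exact: card_graph_family.
exact: ltn_trans lt_ij (card_graph_family _).
Qed.

Theorem theorem10 :
  exists X : nat -> sgraph,
    (forall i j : nat, i <> j -> ~ graph_iso (X i) (X j)) /\
    (forall i : nat,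
       [/\ connected_graph (X i), valent 6 (X i), cayley_graph (X i)
         & ~ exists D : {set {set {set X i}}}, hamilton_decomposition 6 D]).
Proof.
exists (fun i => graph_family (spaced_index i)); split; last first.
  by move=> i; apply: graph_familyP.
move=> i j neq_ij [f [/bij_eq_card eq_card _]].
have [/card_spaced | /card_spaced | //] := ltngtP i j; by rewrite eq_card ltnn.
Qed.
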